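(* Let $A$ be a Banach algebra such that its multiplier algebra $M(A)$ admits the structure of a dual Banach algebra in such a way that $A$ is weak*-dense in $M(A)$. Suppose that for every closed left ideal $I$ in $A$ there exist $n\in\mathbb{N}$ and $\mu_1,\ldots,\mu_n\in M(A)$ such that $I=\overline{A^\sharp\mu_1+\cdots+A^\sharp\mu_n}$ (norm closure). Then $M(A)$ is weak*-topologically left Noetherian. In particular, $M(A)$ is weak*-topologically left Noetherian whenever $A$ is topologically left Noetherian in the norm topology.
   Context: The multiplier algebra $M(A)$ of a Banach algebra $A$ is the unital Banach algebra of pairs $\mu=(L,R)$ of bounded linear maps $A\to A$ satisfying $L(ab)=L(a)b$, $R(ab)=aR(b)$ and $aL(b)=R(a)b$ for all $a,b\in A$, with product $(L,R)(L',R')=(LL',R'R)$ and norm $\max(\|L\|,\|R\|)$; one writes $\mu a=L(a)$ and $a\mu=R(a)$. The canonical map $A\to M(A)$ sends $a$ to the pair (left multiplication by $a$, right multiplication by $a$); its image is a two-sided ideal of $M(A)$. Elements of $A$ are regarded as elements of $M(A)$ via this map; in particular ''$A$ is weak*-dense in $M(A)$'' means that the image of $A$ under it is weak*-dense. $A^\sharp$ denotes the (conditional) unitisation of $A$ ($A^\sharp=A$ if $A$ is unital, and $A$ with an identity adjoined otherwise), and the identity of $A^\sharp$ acts as the identity on $M(A)$. In the displayed equality for $I$ the closure is the norm closure in $A$. A dual Banach algebra is a Banach algebra $B$ that is (isomorphically) a dual Banach space in such a way that multiplication is separately weak*-continuous. A unital dual Banach algebra $B$ is weak*-topologically left Noetherian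 if for every weak*-closed left ideal $J$ of $B$ there exist $n\in\mathbb{N}$ and $x_1,\ldots,x_n\in J$ with $J=\overline{Bx_1+\cdots+Bx_n}^{w^*}$. $A$ is topologically left Noetherian (in norm) if for every closed left ideal $I$ of $A$ there exist $n\in\mathbb{N}$ and $x_1,\ldots,x_n\in I$ with $I=\overline{A^\sharp x_1+\cdots+A^\sharp x_n}$. *)

(* Defs.v *)
(* Scalars are the complex numbers R[i] over R : realType. *)
From HB Require Import structures.
From mathcomp Require Import all_boot all_order all_algebra complex.
From mathcomp Require Import all_classical all_reals all_analysis.

Set Implicit Arguments.
Unset Strict Implicit.
Unset Printing Implicit Defensive.

Import Order.TTheory GRing.Theory Num.Theory.
Import numFieldNormedType.Exports.

Local Open Scope classical_set_scope.
Local Open Scope ring_scope.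

(* Banach algebras, not necessarily unital: the multiplication cannot be the
   one of a MathComp ring, which has an identity. *)
HB.mixin Record CompleteNormedModule_isBanachAlgebra (K : numFieldType) A
    & CompleteNormedModule K A := {
  bmul : A -> A -> A;
  bmulA : associative bmul;
  bmulDl : left_distributive bmul +%R;
  bmulDr : right_distributive bmul +%R;
  bmulZl : forall (k : K) (a b : A), bmul (k *: a) b = k *: bmul a b;
  bmulZr : forall (k : K) (a b : A), bmul a (k *: b) = k *: bmul a b;
  normr_bmul : forall a b : A, `|bmul a b| <= `|a| * `|b|
}.

#[short(type="banachAlgType")]
HB.structure Definition BanachAlgebra (K : numFieldType) :=
  {A of CompleteNormedModule_isBanachAlgebra K A & CompleteNormedModule K A}.

Notation "a ** b" := (bmul a b) (at level 40, left associativity) : ring_scope.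

Definition is_identity (K : numFieldType) (A : banachAlgType K) (e : A) :=
  forall a : A, e ** a = a /\ a ** e = a.

Definition unital (K : numFieldType) (A : banachAlgType K) :=
  exists e : A, is_identity e.

Definition left_ideal (K : numFieldType) (A : banachAlgType K) (J : set A) :=
  [/\ J 0,
      forall x y, J x -> J y -> J (x + y),
      forall (k : K) x, J x -> J (k *: x) &
      forall b x, J x -> J (b ** x)].

Section BoundedOperators.
Context {R : realType} (V W : normedModType R[i]).

Definition bounded_op_pred : {pred V -> W} :=
  fun f => `[< linear f /\ continuous f >].

Record bounded_op := BoundedOp {
  bop_fun :> V -> W;
  _ : bop_fun \in bounded_op_pred
}.

HB.instance Definition _ := [isSub for bop_fun].
HB.instance Definition _ := [Choice of bounded_op by <:].

Fact bounded_op_submod_closed : submod_closed bounded_op_pred.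
Proof.
split=> [|k f g].
  apply/asboolP; split; last by move=> x; exact: cvg_cst.
  by move=> a x y; change (0 = a *: 0 + 0 :> W); rewrite scaler0 addr0.
move=> fS gS.
have [fl fc] : linear f /\ continuous f by exact/asboolP.
have [gl gc] : linear g /\ continuous g by exact/asboolP.
apply/asboolP; split.
  move=> a x y.
  change (k *: f (a *: x + y) + g (a *: x + y) =
          a *: (k *: f x + g x) + (k *: f y + g y)).
  rewrite fl gl !scalerDr !scalerA [k * a]mulrC.
  by rewrite addrACA.
by move=> x; apply: cvgD; [apply: cvgZl_tmp; exact: fc|exact: gc].
Qed.

HB.instance Definition _ := GRing.isSubmodClosed.Build _ _ bounded_op_pred
  bounded_op_submod_closed.
HB.instance Definition _ := [SubChoice_isSubLmodule of bounded_op by <:].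

Lemma bop_linear (f : bounded_op) : linear f.
Proof. by have /asboolP[] := valP f. Qed.

Lemma bop_continuous (f : bounded_op) : continuous f.
Proof. by have /asboolP[] := valP f. Qed.

HB.instance Definition _ (f : bounded_op) :=
  GRing.isLinear.Build _ _ _ _ (bop_fun f) (bop_linear f).

Lemma bopP (f g : bounded_op) : (forall x, f x = g x) -> f = g.
Proof. by move=> fg; apply/val_inj/funext. Qed.

Lemma bopD (f g : bounded_op) x : (f + g) x = f x + g x. Proof. by []. Qed.
Lemma bopN (f : bounded_op) x : (- f) x = - f x. Proof. by []. Qed.
Lemma bopB (f g : bounded_op) x : (f - g) x = f x - g x. Proof. by []. Qed.
Lemma bopZ k (f : bounded_op) x : (k *: f) x = k *: f x. Proof. by []. Qed.
Lemma bop0 x : (0 : bounded_op) x = 0. Proof. by []. Qed.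

(* Norms are nonnegative real elements of R[i], so that the supremum is taken
   in R through complex.Re. *)
Definition opnorm (f : bounded_op) : R[i] :=
  (sup [set complex.Re `|f x| | x in [set x : V | `|x| <= 1]])%:C%C.

Lemma ReK_ge0 (z : R[i]) : 0 <= z -> (complex.Re z)%:C%C = z.
Proof. by case: z => a b; rewrite lecE /= => /andP[/eqP-> _]. Qed.

Lemma opnorm_has_sup (f : bounded_op) :
  has_sup [set complex.Re `|f x| | x in [set x : V | `|x| <= 1]].
Proof.
split; first by exists (complex.Re `|f 0|), 0 => //=; rewrite normr0.
have /linear_bounded_continuous /linear_boundedP :
  continuous (f : {linear V -> W}) by exact: bop_continuous.
move=> /pinfty_ex_gt0[M M0 fM].
exists (complex.Re M) => _ [x /= x1 <-].
rewrite -lecR !ReK_ge0// ?(ltW M0)//.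
by rewrite (le_trans (fM x))// ler_piMr// ltW.
Qed.

Lemma opnorm_ge0 (f : bounded_op) : 0 <= opnorm f.
Proof.
rewrite ler0c; apply: (@le_trans _ _ (complex.Re `|f 0|)).
  by rewrite -ler0c ReK_ge0.
by apply: ub_le_sup; [exact: (opnorm_has_sup f).2|exists 0 => //=; rewrite normr0].
Qed.

Lemma opnorm_le1 (f : bounded_op) x : `|x| <= 1 -> `|f x| <= opnorm f.
Proof.
move=> x1; rewrite -(@ReK_ge0 `|f x|)// lecR.
by apply: ub_le_sup; [exact: (opnorm_has_sup f).2|exists x].
Qed.

Lemma opnormP (f : bounded_op) x : `|f x| <= opnorm f * `|x|.
Proof.
have [->|x0] := eqVneq x 0; first by rewrite linear0 !normr0 mulr0.
have nx0 : 0 < `|x| by rewrite normr_gt0.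
have : `|f (`|x|^-1 *: x)| <= opnorm f.
  by apply: opnorm_le1; rewrite normrZ normfV normr_id mulVf ?gt_eqF.
by rewrite linearZ/= normrZ normfV normr_id mulrC ler_pdivrMr.
Qed.

Lemma opnorm_le (f : bounded_op) (M : R[i]) : 0 <= M -> (forall x, `|f x| <= M * `|x|) ->
  opnorm f <= M.
Proof.
move=> M0 fM; rewrite -(ReK_ge0 M0) lecR.
apply: ge_sup => [|_ [x /= x1 <-]]; first exact: (opnorm_has_sup f).1.
by rewrite -lecR !ReK_ge0// (le_trans (fM x))// ler_piMr.
Qed.

Let opnormD (f g : bounded_op) : opnorm (f + g) <= opnorm f + opnorm g.
Proof.
apply: opnorm_le => [|x]; first by rewrite addr_ge0 ?opnorm_ge0.
by rewrite bopD (le_trans (ler_normD _ _))// mulrDl lerD ?opnormP.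
Qed.

Let opnormZ (k : R[i]) (f : bounded_op) : opnorm (k *: f) = `|k| * opnorm f.
Proof.
have H (l : R[i]) g : opnorm (l *: g) <= `|l| * opnorm g.
  apply: opnorm_le => [|x]; first by rewrite mulr_ge0 ?opnorm_ge0.
  by rewrite bopZ normrZ -mulrA ler_wpM2l ?opnormP.
apply/eqP; rewrite eq_le H /=.
have [->|k0] := eqVneq k 0; first by rewrite normr0 mul0r opnorm_ge0.
rewrite mulrC -ler_pdivlMr ?normr_gt0// mulrC -normfV.
by apply: le_trans (H _ _); rewrite scalerA mulVf// scale1r.
Qed.

Let opnorm0_eq0 (f : bounded_op) : opnorm f = 0 -> f = 0.
Proof.
move=> f0; apply: bopP => x; apply/eqP; rewrite -normr_le0.
by rewrite (le_trans (opnormP f x))// f0 mul0r.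
Qed.

HB.instance Definition _ := Lmodule_isNormed.Build R[i] bounded_op
  opnormD opnormZ opnorm0_eq0.

Lemma bop_normE (f : bounded_op) : `|f| = opnorm f. Proof. by []. Qed.

Lemma bop_le (f : bounded_op) x : `|f x| <= `|f| * `|x|.
Proof. exact: opnormP. Qed.

End BoundedOperators.

Arguments bounded_op_pred {R} V W.

Section BoundedOperatorsExtra.
Context {R : realType}.
Implicit Types U V W : normedModType R[i].

Lemma bounded_op_memP V W (f : V -> W) (M : R[i]) : linear f -> 0 <= M ->
  (forall x, `|f x| <= M * `|x|) -> f \in bounded_op_pred V W.
Proof.
move=> fl M0 fM; apply/asboolP; split => //.
pose g : {linear V -> W} := HB.pack f (GRing.isLinear.Build _ _ _ _ _ fl).
apply: (@bounded_linear_continuous _ _ _ g); apply/linear_boundedP.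
exists M; split; first exact: ger0_real.
by move=> r Mr x; rewrite (le_trans (fM x))// ler_wpM2r// ltW.
Qed.

Fact bop_comp_subproof U V W (f : bounded_op V W) (g : bounded_op U V) :
  f \o g \in bounded_op_pred U W.
Proof.
apply: (@bounded_op_memP _ _ _ (`|f| * `|g|)).
- by move=> k x y; rewrite /= !linearP.
- by rewrite mulr_ge0.
- by move=> x /=; rewrite (le_trans (bop_le f _))// -mulrA ler_wpM2l// bop_le.
Qed.

Definition bop_comp U V W (f : bounded_op V W) (g : bounded_op U V) :
  bounded_op U W := BoundedOp (bop_comp_subproof f g).

Fact bop_id_subproof V : (idfun : V -> V) \in bounded_op_pred V V.
Proof. by apply: (@bounded_op_memP _ _ _ 1) => // x; rewrite mul1r. Qed.

Definition bop_id V : bounded_op V V := BoundedOp (bop_id_subproof V).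

Lemma normr_bop_comp U V W (f : bounded_op V W) (g : bounded_op U V) :
  `|bop_comp f g| <= `|f| * `|g|.
Proof.
rewrite [leLHS]bop_normE; apply: opnorm_le => [|x]; first by rewrite mulr_ge0.
by rewrite (le_trans (bop_le f _))// -mulrA ler_wpM2l// bop_le.
Qed.

End BoundedOperatorsExtra.

Section BoundedOperatorsComplete.
Context {R : realType} (V : normedModType R[i]) (W : completeNormedModType R[i]).

Lemma bop_eval_cauchy (F : set_system (bounded_op V W)) x : ProperFilter F ->
  cauchy F -> cvg ((f : bounded_op V W) x @[f --> F]).
Proof.
move=> FF /cauchyP Fc; apply: cauchy_cvg; apply: cauchy_exP => e e0.
have x1 : 0 < 1 + `|x| by rewrite ltr_wpDr.
have /Fc[g Fg] : 0 < e / (1 + `|x|) by rewrite divr_gt0.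
exists (g x); change (F [set f : bounded_op V W | ball (g x) e (f x)]).
apply: filterS Fg => f; rewrite /= -!ball_normE/= => fg.
rewrite -(bopB g f) (le_lt_trans (bop_le _ _))//.
have [->|x0] := eqVneq x 0; first by rewrite normr0 mulr0.
have nx0 : 0 < `|x| by rewrite normr_gt0.
rewrite (@lt_trans _ _ (e / (1 + `|x|) * `|x|)) ?ltr_pM2r//.
by rewrite mulrAC ltr_pdivrMr// ltr_pM2l// ltrDr.
Qed.

Lemma bop_complete (F : set_system (bounded_op V W)) :
  ProperFilter F -> cauchy F -> cvg F.
Proof.
move=> FF Fc; pose l x := lim ((f : bounded_op V W) x @[f --> F]).
have lE x : (f : bounded_op V W) x @[f --> F] --> l x.
  exact: bop_eval_cauchy.
have l_lin : linear l.
  move=> k x y; apply: (cvg_unique (@norm_hausdorff _ _) (lE _)).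
  have -> : (fun f : bounded_op V W => f (k *: x + y)) =
      (fun f : bounded_op V W => k *: f x + f y).
    by apply/funext => f; exact: bop_linear.
  by apply: cvgD => //; apply: cvgZl_tmp.
have lb e (g : bounded_op V W) : F (ball g e) ->
    forall x, `|l x - g x| <= e * `|x|.
  move=> Fg x; apply/ler_addgt0Pl => d d0.
  have /cvgrPdist_lt/(_ _ d0) Fd := lE x.
  have [f [fd]] := filter_ex (filterI Fd Fg).
  rewrite -ball_normE/= distrC => fg.
  rewrite (le_trans (ler_distD (f x) _ _))// lerD//; first exact: ltW.
  by rewrite -(bopB f g) (le_trans (bop_le _ _))// ler_wpM2r// ltW.
have l_in : l \in bounded_op_pred V W.
  have /cauchyP/(_ 1 ltr01)[g Fg] := Fc.
  apply: (@bounded_op_memP _ _ _ _ (1 + `|g|)) => //.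
  move=> x; rewrite -[l x](subrK (g x)) (le_trans (ler_normD _ _))// mulrDl.
  by rewrite lerD ?bop_le// (lb 1 g).
apply/cvg_ex; exists (BoundedOp l_in); apply/cvgrPdist_lt => e e0.
have /cauchyP/(_ (e / 2)) := Fc; rewrite divr_gt0// => /(_ isT)[g Fg].
apply: filterS (Fg) => f; rewrite -ball_normE/= => gf.
rewrite (le_lt_trans (ler_distD g _ _))// [ltRHS](splitr e) ler_ltD//.
rewrite bop_normE; apply: opnorm_le => [|x]; last exact: (lb (e / 2) g).
by rewrite ltW// divr_gt0.
Qed.

HB.instance Definition _ :=
  Uniform_isComplete.Build (bounded_op V W) bop_complete.

Lemma cvg_bop_eval (F : set_system (bounded_op V W)) (g : bounded_op V W) x :
  Filter F -> F --> g -> (f : bounded_op V W) x @[f --> F] --> g x.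
Proof.
move=> FF Fg; apply/cvgrPdist_lt => e e0.
have x1 : 0 < 1 + `|x| by rewrite ltr_wpDr.
have e1 : 0 < e / (1 + `|x|) by rewrite divr_gt0.
have /cvgrPdist_lt/(_ _ e1) := Fg.
move=> Ffg; apply: (filterS _ Ffg) => f fg.
rewrite -(bopB g f) (le_lt_trans (bop_le _ _))//.
have [->|x0] := eqVneq x 0; first by rewrite normr0 mulr0.
have nx0 : 0 < `|x| by rewrite normr_gt0.
rewrite (@lt_trans _ _ (e / (1 + `|x|) * `|x|)) ?ltr_pM2r//.
by rewrite mulrAC ltr_pdivrMr// ltr_pM2l// ltrDr.
Qed.

End BoundedOperatorsComplete.

Section BanachAlgebraTheory.
Context {R : realType} (A : banachAlgType R[i]).
Implicit Types a b : A.

Fact bmull_subproof a : (fun b => a ** b) \in bounded_op_pred A A.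
Proof.
apply: (@bounded_op_memP _ _ _ _ `|a|) => // [k x y|x].
  by rewrite bmulDr bmulZr.
exact: normr_bmul.
Qed.

Fact bmulr_subproof a : (fun b => b ** a) \in bounded_op_pred A A.
Proof.
apply: (@bounded_op_memP _ _ _ _ `|a|) => // [k x y|x].
  by rewrite bmulDl bmulZl.
by rewrite mulrC; exact: normr_bmul.
Qed.

Definition bmull a : bounded_op A A := BoundedOp (bmull_subproof a).
Definition bmulr a : bounded_op A A := BoundedOp (bmulr_subproof a).

Lemma bmul0l a : 0 ** a = 0. Proof. exact: (linear0 (bmulr a)). Qed.
Lemma bmul0r a : a ** 0 = 0. Proof. exact: (linear0 (bmull a)). Qed.

End BanachAlgebraTheory.

Section Multiplier.
Context {R : realType} (A : banachAlgType R[i]).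

Definition multiplier_pred : {pred bounded_op A A * bounded_op A A} :=
  fun LR => `[< [/\ forall a b, LR.1 (a ** b) = LR.1 a ** b,
                    forall a b, LR.2 (a ** b) = a ** LR.2 b &
                    forall a b, a ** LR.1 b = LR.2 a ** b] >].

Record multiplier := Multiplier {
  mult_pair : bounded_op A A * bounded_op A A;
  _ : mult_pair \in multiplier_pred
}.

HB.instance Definition _ := [isSub for mult_pair].
HB.instance Definition _ := [Choice of multiplier by <:].

Definition mulL (m : multiplier) : bounded_op A A := (mult_pair m).1.
Definition mulR (m : multiplier) : bounded_op A A := (mult_pair m).2.

Lemma multiplierP (m : multiplier) :
  [/\ forall a b, mulL m (a ** b) = mulL m a ** b,
      forall a b, mulR m (a ** b) = a ** mulR m b &
      forall a b, a ** mulL m b = mulR m a ** b].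
Proof. by have /asboolP := valP m. Qed.

Fact multiplier_submod_closed : submod_closed multiplier_pred.
Proof.
split=> [|k p q pS qS].
  by apply/asboolP; split => a b; rewrite ?bop0 ?bmul0l ?bmul0r.
have [pl pr plr] : [/\ forall a b, p.1 (a ** b) = p.1 a ** b,
    forall a b, p.2 (a ** b) = a ** p.2 b &
    forall a b, a ** p.1 b = p.2 a ** b] by exact/asboolP.
have [ql qr qlr] : [/\ forall a b, q.1 (a ** b) = q.1 a ** b,
    forall a b, q.2 (a ** b) = a ** q.2 b &
    forall a b, a ** q.1 b = q.2 a ** b] by exact/asboolP.
apply/asboolP.
rewrite -[(k *: p + q).1]/(k *: p.1 + q.1) -[(k *: p + q).2]/(k *: p.2 + q.2).
split=> a b; rewrite !bopD !bopZ.
- by rewrite pl ql bmulDl bmulZl.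
- by rewrite pr qr bmulDr bmulZr.
- by rewrite bmulDr bmulZr plr qlr bmulDl bmulZl.
Qed.

HB.instance Definition _ := GRing.isSubmodClosed.Build _ _ multiplier_pred
  multiplier_submod_closed.
HB.instance Definition _ := [SubChoice_isSubLmodule of multiplier by <:].

Definition mult_norm (m : multiplier) : R[i] := Num.max `|mulL m| `|mulR m|.

(* the norm of a product space is the maximum of the norms *)
Let mult_normE (m : multiplier) : mult_norm m = `|mult_pair m|.
Proof. by rewrite prod_normE. Qed.

Let mult_normD (m n : multiplier) :
  mult_norm (m + n) <= mult_norm m + mult_norm n.
Proof. by rewrite !mult_normE ler_normD. Qed.

Let mult_normZ (k : R[i]) (m : multiplier) :
  mult_norm (k *: m) = `|k| * mult_norm m.
Proof. by rewrite !mult_normE normrZ. Qed.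

Let mult_norm0_eq0 (m : multiplier) : mult_norm m = 0 -> m = 0.
Proof. by rewrite mult_normE => /normr0_eq0 m0; apply: val_inj. Qed.

HB.instance Definition _ := Lmodule_isNormed.Build R[i] multiplier
  mult_normD mult_normZ mult_norm0_eq0.

Lemma normr_multE (m : multiplier) : `|m| = Num.max `|mulL m| `|mulR m|.
Proof. by []. Qed.

Lemma normr_mulL_le (m : multiplier) : `|mulL m| <= `|m|.
Proof.
by rewrite normr_multE comparable_le_max ?lexx// real_comparable ?normr_real.
Qed.

Lemma normr_mulR_le (m : multiplier) : `|mulR m| <= `|m|.
Proof.
rewrite normr_multE comparable_le_max ?lexx ?orbT//.
by rewrite real_comparable ?normr_real.
Qed.

Lemma normr_mult_le (m : multiplier) (M : R[i]) :
  `|mulL m| <= M -> `|mulR m| <= M -> `|m| <= M.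
Proof. by move=> mL mR; rewrite normr_multE /Order.max; case: ifP. Qed.

Lemma normr_mult_lt (m : multiplier) (M : R[i]) :
  `|mulL m| < M -> `|mulR m| < M -> `|m| < M.
Proof. by move=> mL mR; rewrite normr_multE /Order.max; case: ifP. Qed.

Lemma multiplier_complete (F : set_system multiplier) :
  ProperFilter F -> cauchy F -> cvg F.
Proof.
move=> FF /cauchyP Fc.
have cL : cvg (mulL m @[m --> F]).
  apply: cauchy_cvg; apply: cauchy_exP => e /Fc[m Fm]; exists (mulL m).
  change (F [set n | ball (mulL m) e (mulL n)]).
  apply: filterS Fm => n; rewrite /= -!ball_normE/=.
  exact/le_lt_trans/(normr_mulL_le (m - n)).
have cR : cvg (mulR m @[m --> F]).
  apply: cauchy_cvg; apply: cauchy_exP => e /Fc[m Fm]; exists (mulR m).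
  change (F [set n | ball (mulR m) e (mulR n)]).
  apply: filterS Fm => n; rewrite /= -!ball_normE/=.
  exact/le_lt_trans/(normr_mulR_le (m - n)).
pose L := lim (mulL m @[m --> F]); pose S := lim (mulR m @[m --> F]).
have evL a : mulL m a @[m --> F] --> L a.
  exact: (@cvg_bop_eval _ _ _ _ _ a _ cL).
have evR a : mulR m a @[m --> F] --> S a.
  exact: (@cvg_bop_eval _ _ _ _ _ a _ cR).
have lmul (f : multiplier -> A) (l : A) a :
    f m @[m --> F] --> l -> a ** f m @[m --> F] --> a ** l.
  by move=> fl; exact: (cvg_comp _ _ fl (@bop_continuous _ _ _ (bmull a) l)).
have rmul (f : multiplier -> A) (l : A) a :
    f m @[m --> F] --> l -> f m ** a @[m --> F] --> l ** a.
  by move=> fl; exact: (cvg_comp _ _ fl (@bop_continuous _ _ _ (bmulr a) l)).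
have LS : (L, S) \in multiplier_pred.
  apply/asboolP; split => a b /=;
    apply: (cvg_unique (@norm_hausdorff _ A) (F := _ @ F)).
  - exact: evL.
  - rewrite (_ : (fun m => _) = fun m => mulL m a ** b); last first.
      by apply/funext => m; have [-> _ _] := multiplierP m.
    exact: rmul.
  - exact: evR.
  - rewrite (_ : (fun m => _) = fun m => a ** mulR m b); last first.
      by apply/funext => m; have [_ -> _] := multiplierP m.
    exact: lmul.
  - exact: lmul (evL b).
  - rewrite (_ : (fun m => _) = fun m => mulR m a ** b); last first.
      by apply/funext => m; have [_ _ ->] := multiplierP m.
    exact: rmul.
apply/cvg_ex; exists (Multiplier LS); apply/cvgrPdist_lt => e e0.
have /cvgrPdist_lt/(_ _ e0) FL : mulL m @[m --> F] --> L by exact: cL.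
have /cvgrPdist_lt/(_ _ e0) FS : mulR m @[m --> F] --> S by exact: cR.
have {}FL : F [set m | `|L - mulL m| < e] := FL.
have {}FS : F [set m | `|S - mulR m| < e] := FS.
by apply: filterS (filterI FL FS) => m [? ?]; exact: normr_mult_lt.
Qed.

HB.instance Definition _ :=
  Uniform_isComplete.Build multiplier multiplier_complete.

Fact mult_mul_subproof (m n : multiplier) :
  (bop_comp (mulL m) (mulL n), bop_comp (mulR n) (mulR m))
    \in multiplier_pred.
Proof.
have [ml mr mlr] := multiplierP m; have [nl nr nlr] := multiplierP n.
apply/asboolP; split => a b /=; first by rewrite nl ml.
  by rewrite mr nr.
by rewrite mlr nlr.
Qed.

Definition mult_mul (m n : multiplier) : multiplier :=
  Multiplier (mult_mul_subproof m n).

Lemma multiplier_eq (m n : multiplier) :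
  (forall a, mulL m a = mulL n a) -> (forall a, mulR m a = mulR n a) -> m = n.
Proof.
move=> mnL mnR; apply: val_inj => /=.
rewrite [LHS]surjective_pairing [RHS]surjective_pairing.
by congr pair; apply: bopP.
Qed.

Let mult_mulA : associative mult_mul.
Proof. by move=> m n p; apply: multiplier_eq. Qed.

Let mult_mulDl : left_distributive mult_mul +%R.
Proof.
move=> m n p; apply: multiplier_eq => a //.
exact: (linearD (mulR p) (mulR m a) (mulR n a)).
Qed.

Let mult_mulDr : right_distributive mult_mul +%R.
Proof.
move=> m n p; apply: multiplier_eq => a //.
exact: (linearD (mulL m) (mulL n a) (mulL p a)).
Qed.

Let mult_mulZl (k : R[i]) (m n : multiplier) :
  mult_mul (k *: m) n = k *: mult_mul m n.
Proof.
apply: multiplier_eq => a //.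
exact: (linearZ_LR (mulR n) k (mulR m a)).
Qed.

Let mult_mulZr (k : R[i]) (m n : multiplier) :
  mult_mul m (k *: n) = k *: mult_mul m n.
Proof.
apply: multiplier_eq => a //.
exact: (linearZ_LR (mulL m) k (mulL n a)).
Qed.

Let normr_mult_mul (m n : multiplier) : `|mult_mul m n| <= `|m| * `|n|.
Proof.
apply: normr_mult_le; apply: (le_trans (normr_bop_comp _ _)).
  by rewrite ler_pM// normr_mulL_le.
by rewrite mulrC ler_pM// normr_mulR_le.
Qed.

HB.instance Definition _ := CompleteNormedModule_isBanachAlgebra.Build R[i]
  multiplier mult_mulA mult_mulDl mult_mulDr mult_mulZl mult_mulZr
  normr_mult_mul.

Fact mult_one_subproof : (bop_id A, bop_id A) \in multiplier_pred.
Proof. by apply/asboolP; split. Qed.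

Definition mult_one : multiplier := Multiplier mult_one_subproof.

Lemma mult_one_identity : is_identity mult_one.
Proof. by move=> m; split; apply: multiplier_eq. Qed.

Fact canonical_mult_subproof (a : A) : (bmull a, bmulr a) \in multiplier_pred.
Proof. by apply/asboolP; split => b c /=; rewrite bmulA. Qed.

Definition canonical_mult (a : A) : multiplier :=
  Multiplier (canonical_mult_subproof a).

End Multiplier.

Section DualBanachAlgebra.
Context {R : realType}.

Record predual_structure (B : normedModType R[i]) := PredualStructure {
  predual : completeNormedModType R[i];
  dual_iso : {linear B -> bounded_op predual R[i]^o};
  dual_iso_inv : bounded_op predual R[i]^o -> B;
  dual_isoK : cancel dual_iso dual_iso_inv;
  dual_iso_invK : cancel dual_iso_inv dual_iso;
  dual_iso_continuous : continuous dual_iso;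
  dual_iso_inv_continuous : continuous dual_iso_inv
}.

Definition weak_star (B : normedModType R[i]) (P : predual_structure B) : Type :=
  initial_topology (fun b : B =>
    (dual_iso P b : predual P -> R[i]^o) : {ptws predual P -> R[i]^o}).

HB.instance Definition _ (B : normedModType R[i]) (P : predual_structure B) :=
  Topological.on (weak_star P).

Definition dual_banach_algebra (B : banachAlgType R[i])
    (P : predual_structure B) :=
  forall b : B,
    continuous (fun x : weak_star P => (b ** (x : B)) : weak_star P) /\
    continuous (fun x : weak_star P => ((x : B) ** b) : weak_star P).

Definition weak_star_left_noetherian (B : banachAlgType R[i])
    (P : predual_structure B) :=
  forall J : set B, closed (J : set (weak_star P)) -> left_ideal J ->
  exists (n : nat) (x : 'I_n -> B), (forall i, J (x i)) /\
    J = closure ([set \sum_(i < n) b i ** x i | b in [set: 'I_n -> B]]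
                   : set (weak_star P)).

End DualBanachAlgebra.

Section Unitisation.
Context {R : realType} (A : banachAlgType R[i]).

(* A^# is encoded as a set of pairs (a, k) standing for a + k1: all of them if
   A is not unital, and only those with k = 0, i.e. A itself, otherwise. *)
Definition unitisation : set (A * R[i]) := [set u | unital A -> u.2 = 0].

Definition unitisation_span (n : nat) (x : 'I_n -> A) : set A :=
  [set \sum_(i < n) ((u i).1 ** x i + (u i).2 *: x i)
     | u in [set u : 'I_n -> A * R[i] | forall i, unitisation (u i)]].

Definition unitisation_mult_span (n : nat) (m : 'I_n -> multiplier A) :
    set (multiplier A) :=
  [set \sum_(i < n) (canonical_mult (u i).1 ** m i + (u i).2 *: m i)
     | u in [set u : 'I_n -> A * R[i] | forall i, unitisation (u i)]].

Definition left_noetherian :=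
  forall I : set A, closed I -> left_ideal I ->
  exists (n : nat) (x : 'I_n -> A), (forall i, I (x i)) /\
    I = closure (unitisation_span x).

(* The sum A^# m_1 + ... + A^# m_n consists of elements of M(A); it is
   regarded as the set S of elements of A that the canonical map sends onto
   it, S being determined by the sum when that map is injective. *)
Definition multiplier_generated :=
  forall I : set A, closed I -> left_ideal I ->
  exists (n : nat) (m : 'I_n -> multiplier A) (S : set A),
    @canonical_mult R A @` S = unitisation_mult_span m /\ I = closure S.

End Unitisation.

(* Main.v *)
(* Pull a weak*-closed left ideal J of M(A) back to I = {a | a in J}, a closed
   left ideal of A, and write I as the norm closure of A^# m_1 + ... + A^# m_n.
   Each m_i lies in A^# m_i, hence in J.  The weak*-closure K of
   M(A) m_1 + ... + M(A) m_n contains I, because the weak* topology is coarser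
   than the norm topology.  If m is in J then A m is contained in I since A is
   an ideal of M(A), so the weak*-closed set {x | x m in K} contains A; by
   density it contains 1, that is, m is in K. *)
Require Import Defs.
From HB Require Import structures.
From mathcomp Require Import all_boot all_order all_algebra complex.
From mathcomp Require Import all_classical all_reals all_analysis.

Import Order.TTheory GRing.Theory Num.Theory.
Import numFieldNormedType.Exports.

Local Open Scope classical_set_scope.
Local Open Scope ring_scope.

Lemma closure_subset_closed {T : topologicalType} {A B : set T} :
  closed B -> A `<=` B -> closure A `<=` B.
Proof. by move=> cB AB; apply: subset_trans cB; exact: closureS. Qed.

Lemma dense_closure {T : topologicalType} {A : set T} :
  dense A -> closure A = [set: T].
Proof.
move=> dA; apply/seteqP; split=> // x _; rewrite closureEonbhs.
move=> B C AB [oC Cx].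
have [y [Cy Ay]] := dA C (ex_intro _ x Cx) oC.
by exists y; split=> //; exact: AB.
Qed.

(** Evaluation at [t] is itself a linear operator, bounded by [|t|]. *)
Lemma continuous_bop_eval {R : realType} {V W : normedModType R[i]} (t : V) :
  continuous (fun f : bounded_op V W => f t).
Proof.
have /asboolP[] // : (fun f : bounded_op V W => f t) \in
    bounded_op_pred (bounded_op V W) W.
apply: (@bounded_op_memP _ _ _ _ `|t|) => // f.
by rewrite mulrC; exact: bop_le.
Qed.

(** The weak* topology is initial for pointwise evaluation on the predual, so it suffices that each
    evaluation of [dual_iso] at a fixed [t] is norm continuous. *)
Lemma continuous_weak_star {R : realType} {B : normedModType R[i]}
    (P : predual_structure B) :
  continuous ((fun b => b) : B -> weak_star P).
Proof.
apply: continuous_comp_initial => b.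
apply/pointwise_cvgP => t.
apply: (@continuous_comp B (bounded_op (predual P) R[i]^o) R[i]^o
  (dual_iso P) (fun f => f t)).
  exact: dual_iso_continuous.
exact: continuous_bop_eval.
Qed.

Section CanonicalMap.
Context {R : realType} (A : banachAlgType R[i]).
Implicit Types (a b : A) (m : multiplier A).

Lemma canonical_mult_linear : linear (@canonical_mult R A).
Proof.
move=> k a b; apply: multiplier_eq => c.
  by rewrite [LHS]bmulDl bmulZl.
by rewrite [LHS]bmulDr bmulZr.
Qed.

HB.instance Definition _ := GRing.isLinear.Build R[i] A (multiplier A) _
  (@canonical_mult R A) canonical_mult_linear.

Lemma canonical_mult_mul a b :
  canonical_mult (a ** b) = canonical_mult a ** canonical_mult b.
Proof. by apply: multiplier_eq => c; rewrite /= bmulA. Qed.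

(** This is why A absorbs multiplication by M(A) on the right. The left components agree by the
    compatibility aL(b) = R(a)b, the right ones by R(ca) = cR(a). *)
Lemma canonical_mult_mulr a m :
  canonical_mult a ** m = canonical_mult (mulR m a).
Proof.
have [_ mr mlr] := multiplierP m.
by apply: multiplier_eq => c; [exact: mlr|exact: mr].
Qed.

Lemma normr_canonical_mult_le a : `|canonical_mult a| <= `|a|.
Proof.
apply: normr_mult_le; rewrite bop_normE; apply: opnorm_le => // b.
  exact: normr_bmul.
by rewrite mulrC; exact: normr_bmul.
Qed.

Lemma continuous_canonical_mult : continuous (@canonical_mult R A).
Proof.
have /asboolP[] // : @canonical_mult R A \in bounded_op_pred A (multiplier A).
apply: (@bounded_op_memP _ _ _ _ 1) => // [|a].
  exact: canonical_mult_linear.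
by rewrite mul1r; exact: normr_canonical_mult_le.
Qed.

Lemma canonical_mult_identity {e} :
  is_identity e -> canonical_mult e = mult_one A.
Proof. by move=> eP; apply: multiplier_eq => a; have [] := eP a. Qed.

Lemma unitisation_mult_span_generator {n} (m : 'I_n -> multiplier A) i :
  unitisation_mult_span m (m i).
Proof.
have zero : (canonical_mult (0 : A)) = 0 by exact: linear0.
have [[e eP]|nA] := pselect (unital A).
  (* The coefficient of [m i] is the identity of the unitisation: [(e, 0)] if A is unital, where
     scalar parts must vanish, and [(0, 1)] otherwise. *)
  exists (fun j => (if j == i then e else 0, 0)); first by move=> j _.
  rewrite (bigD1 i)//= eqxx canonical_mult_identity// scale0r addr0.
  rewrite (mult_one_identity (m i)).1 big1 ?addr0// => j /negbTE->.
  by rewrite /= zero bmul0l scale0r addr0.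
exists (fun j => (0, if j == i then 1 else 0)); first by move=> j /nA.
rewrite (bigD1 i)//= eqxx zero bmul0l add0r scale1r.
by rewrite big1 ?addr0// => j /negbTE->; rewrite bmul0l scale0r addr0.
Qed.

Lemma unitisation_mult_span_sub n (m : 'I_n -> multiplier A) :
  unitisation_mult_span m `<=`
  [set \sum_(i < n) b i ** m i | b in [set: 'I_n -> multiplier A]].
Proof.
move=> _ [u _ <-].
(* The element a + k1 of the unitisation acts as a multiplier, its adjoined identity becoming that
   of M(A). *)
exists (fun i => canonical_mult (u i).1 + (u i).2 *: mult_one A) => //.
apply: eq_bigr => i _.
by rewrite bmulDl bmulZl (mult_one_identity (m i)).1.
Qed.

Lemma image_unitisation_span n (x : 'I_n -> A) :
  @canonical_mult R A @` unitisation_span x =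
  unitisation_mult_span (fun i => canonical_mult (x i)).
Proof.
have E (u : 'I_n -> A * R[i]) :
    canonical_mult (\sum_(i < n) ((u i).1 ** x i + (u i).2 *: x i)) =
    \sum_(i < n) (canonical_mult (u i).1 ** canonical_mult (x i) +
                  (u i).2 *: canonical_mult (x i)).
  rewrite linear_sum; apply: eq_bigr => i _.
  by rewrite linearD linearZ /= canonical_mult_mul.
apply/seteqP; split=> [_ [_ [u uA <-] <-]|_ [u uA <-]].
  by exists u => //; rewrite E.
exists (\sum_(i < n) ((u i).1 ** x i + (u i).2 *: x i)); last exact: E.
by exists u.
Qed.

Lemma left_noetherian_multiplier_generated :
  left_noetherian A -> multiplier_generated A.
Proof.
move=> nA I cI lI; have [n [x [_ ->]]] := nA I cI lI.
exists n, (fun i => canonical_mult (x i)), (unitisation_span x).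
by split; first exact: image_unitisation_span.
Qed.

Lemma left_ideal_preimage_canonical_mult {J : set (multiplier A)} :
  left_ideal J -> left_ideal (@canonical_mult R A @^-1` J).
Proof.
move=> [J0 JD JZ JM]; split=> [|x y Jx Jy|k x Jx|b x Jx] /=.
- by rewrite linear0.
- by rewrite linearD; exact: JD.
- by rewrite linearZ; exact: JZ.
- by rewrite canonical_mult_mul; exact: JM.
Qed.

End CanonicalMap.

Lemma left_ideal_span {K : numFieldType} {B : banachAlgType K} {J : set B}
    {n : nat} {x : 'I_n -> B} (b : 'I_n -> B) :
  left_ideal J -> (forall i, J (x i)) -> J (\sum_(i < n) b i ** x i).
Proof.
move=> [J0 JD _ JM] Jx.
by elim/big_ind : _ => // i _; exact: JM.
Qed.

Lemma multiplier_generated_weak_star_left_noetherian {R : realType}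
    {A : banachAlgType R[i]} {P : predual_structure (multiplier A)} :
  dual_banach_algebra P ->
  dense (range (@canonical_mult R A) : set (weak_star P)) ->
  multiplier_generated A -> weak_star_left_noetherian P.
Proof.
move=> dualMA denseA genA J cJ lJ.
pose iota : A -> weak_star P := @canonical_mult R A.
have iota_continuous : continuous iota.
  move=> a; apply: (@continuous_comp A (multiplier A) (weak_star P)
    (@canonical_mult R A) (fun b => b)).
    exact: continuous_canonical_mult.
  exact: continuous_weak_star.
have preimage_iota := (continuous_closedP iota).1 iota_continuous.
have [n [m [S [imS IE]]]] := genA _ (preimage_iota J cJ)
  (left_ideal_preimage_canonical_mult _ lJ).
(* Being in the span, [m i] is the image of some [a] in [S], and [closure S] is the preimage of
   [J]. *)
have Jm i : J (m i).
  have := unitisation_mult_span_generator _ m i; rewrite -imS => -[a Sa <-].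
  have : closure S a by exact: subset_closure.
  by rewrite -IE.
exists n, m; split=> //.
set span := [set _ | _ in _].
apply/seteqP; split; last first.
  apply: (@closure_subset_closed (weak_star P)) => // _ [b _ <-].
  exact: left_ideal_span.
(* Since [iota] is norm-to-weak* continuous, the preimage of a weak*-closed set is norm closed;
   hence containing [S] forces it to contain [closure S]. *)
have IK a : J (iota a) -> closure (span : set (weak_star P)) (iota a).
  have sub : closure S `<=` iota @^-1` closure (span : set (weak_star P)).
    apply: closure_subset_closed.
      by apply: preimage_iota; exact: closed_closure.
    move=> b Sb; apply: subset_closure; apply: unitisation_mult_span_sub.
    by rewrite -imS; exists b.
  by move=> Ja; apply: sub; rewrite -IE.
move=> mu Jmu.
pose rmul : weak_star P -> weak_star P := fun x => (x : multiplier A) ** mu.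
(* Separate weak*-continuity enters here, for right multiplication by [mu]. *)
have cK : closed (rmul @^-1` closure (span : set (weak_star P))).
  apply: (continuous_closedP rmul).1; first exact: (dualMA mu).2.
  exact: closed_closure.
have : closure (range iota) (mult_one A : weak_star P).
  by rewrite (dense_closure denseA).
move=> /(closure_subset_closed cK); rewrite /rmul /=.
rewrite (mult_one_identity mu).1; apply.
move=> _ [a _ <-] /=.
have [_ _ _ JM] := lJ.
(* The product of [a] and [mu] is the image of [mulR mu a], an element of A, so [IK] applies; it
   lies in [J] because [J] is a left ideal. *)
rewrite [X in closure _ X]canonical_mult_mulr; apply: IK.
by rewrite /iota -canonical_mult_mulr; exact: JM.
Qed.

Theorem proposition5p3 (R : realType) (A : banachAlgType R[i])
    (P : predual_structure (multiplier A))
    (dualMA : dual_banach_algebra P)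
    (denseA : dense (range (@canonical_mult R A) : set (weak_star P))) :
  (multiplier_generated A -> weak_star_left_noetherian P) /\
  (left_noetherian A -> weak_star_left_noetherian P).
Proof.
have main := multiplier_generated_weak_star_left_noetherian dualMA denseA.
by split=> // /left_noetherian_multiplier_generated.
Qed.
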